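(* Let $r\ge 2$ be an integer, $\mathbf{a}=(a_1,\ldots,a_r)\in\mathbb{C}^r$, $\mathbf{b}=(b_1,\ldots,b_r)\in\mathbb{C}^r$, $\mathbf{m}=(m_1,\ldots,m_r)\in\mathbb{Z}^r$, $\mathbf{n}=(n_1,\ldots,n_r)\in\mathbb{Z}^r$. Put $M=m_1+\cdots+m_r$, $N=n_1+\cdots+n_r$, $m_{\min}=\min_{1\le i\le r}m_i$, $n_{\max}=\max_{1\le i\le r}n_i$ and $$p=\max\{-1,\;M-N-r+1\}.$$ Assume that the components of $\mathbf{a}$ are distinct modulo integers, i.e. $a_i-a_j\notin\mathbb{Z}$ for $i\ne j$ (and that all factors in the formula below are defined). Then there exist complex numbers $\beta_j$, $-n_{\max}\le j\le p-m_{\min}$, independent of $z$, such that for all complex $z$ with $0<|z|<1$ $$ \sum_{i=1}^{r}\frac{(1-\mathbf{b}+a_i)_{\mathbf{m}-n_i}\,z^{-n_i}}{(a_i-\mathbf{a}_{[i]})_{\mathbf{n}_{[i]}-n_i+1}}\; {}_{r}F_{r-1}\!\left(\begin{matrix}\mathbf{b}-a_i\\ 1+\mathbf{a}_{[i]}-a_i\end{matrix}\,\Big|\, z\right) {}_{r}F_{r-1}\!\left(\begin{matrix}1-\mathbf{b}+a_i+\mathbf{m}-n_i\\ 1-\mathbf{a}_{[i]}+a_i+\mathbf{n}_{[i]}-n_i\end{matrix}\,\Big|\, z\right) =(1-z)^{-p-1}\sum_{j=-n_{\max}}^{p-m_{\min}}\beta_j z^{j}, $$ where the sum on the right is $0$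 if it is empty.
   Context: Rising factorial: for $k\in\mathbb{Z}$, $(z)_k=\Gamma(z+k)/\Gamma(z)$ as a rational function of $z$, i.e. $(z)_k=z(z+1)\cdots(z+k-1)$ for $k\ge 0$ (with $(z)_0=1$) and $(z)_k=\frac{1}{(z-1)(z-2)\cdots(z-|k|)}$ for $k<0$. Vector notation: scalars are added to vectors componentwise, e.g. $\mathbf{a}+\beta=(a_1+\beta,\ldots,a_r+\beta)$ and $\mathbf{m}-n_i=(m_1-n_i,\ldots,m_r-n_i)$. For vectors of equal length, $(\mathbf{a})_{\mathbf{n}}=(a_1)_{n_1}\cdots(a_r)_{n_r}$. The symbol $\mathbf{a}_{[j]}$ denotes $\mathbf{a}$ with the $j$-th component omitted. Thus $(1-\mathbf{b}+a_i)_{\mathbf{m}-n_i}=\prod_{l=1}^{r}(1-b_l+a_i)_{m_l-n_i}$ and $(a_i-\mathbf{a}_{[i]})_{\mathbf{n}_{[i]}-n_i+1}=\prod_{l\neq i}(a_i-a_l)_{n_l-n_i+1}$. Generalized hypergeometric function: for $\mathbf{c}\in\mathbb{C}^{s}$, $\mathbf{d}\in\mathbb{C}^{q}$ with no component of $\mathbf{d}$ a nonpositive integer, $${}_{s}F_{q}\!\left(\begin{matrix}\mathbf{c}\\ \mathbf{d}\end{matrix}\,\Big|\,z\right)=\sum_{k=0}^{\infty}\frac{(c_1)_k\cdots(c_s)_k}{(d_1)_k\cdots(d_q)_k}\frac{z^k}{k!}.$$ When $s=q+1$ the series converges for $|z|<1$. In the formula the upper parameters of the first function are $b_l-a_i$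 ($1\le l\le r$) and the lower ones $1+a_l-a_i$ ($l\ne i$); the upper parameters of the second are $1-b_l+a_i+m_l-n_i$ ($1\le l\le r$) and the lower ones $1-a_l+a_i+n_l-n_i$ ($l\ne i$). ''All factors are defined'' means that for each $i,l$ the factor $(1-b_l+a_i)_{m_l-n_i}$ is defined, i.e. if $m_l<n_i$ then $1-b_l+a_i\notin\{1,2,\ldots,n_i-m_l\}$. *)

(* Defs.v *)
From HB Require Import structures.
From mathcomp Require Import all_boot all_order all_algebra.
From mathcomp Require Import complex.
From mathcomp Require Import all_classical all_reals topology normedtype sequences.

Set Implicit Arguments.
Unset Strict Implicit.
Unset Printing Implicit Defensive.

Import Order.TTheory GRing.Theory Num.Theory.
Import numFieldNormedType.Exports.

Local Open Scope classical_set_scope.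
Local Open Scope ring_scope.

(* (z)_k for k : int.  Since 0^-1 = 0 in MathComp, the value at a pole (k < 0
   and z in {1, ..., -k}) is the junk value 0; see [rising_defined]. *)
Definition rising (K : numFieldType) (z : K) (k : int) : K :=
  match k with
  | Posz n => \prod_(0 <= j < n) (z + j%:R)
  | Negz n => (\prod_(1 <= j < n.+2) (z - j%:R))^-1  (* here k = - n.+1 *)
  end.

(* vacuous for 0 <= k *)
Definition rising_defined (K : numFieldType) (z : K) (k : int) : Prop :=
  forall j : nat, (0 < j)%N -> j%:Z <= - k -> z <> j%:R.

(* Generalized hypergeometric series with upper parameters [c] and lower
   parameters [d]; [limn] is total, and is the sum of the series only when the
   latter converges. *)
Definition hypergeom (K : numFieldType) (c d : seq K) (z : K) : K :=
  limn (series (fun k : nat =>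
    (\prod_(x <- c) rising x k) / (\prod_(y <- d) rising y k)
      * (z ^+ k / k`!%:R))).

(* Main.v *)
Require Import Defs.
From HB Require Import structures.
From mathcomp Require Import all_boot all_order all_algebra.
From mathcomp Require Import complex.
From mathcomp Require Import all_classical all_reals topology normedtype sequences.
From mathcomp Require Import ring lra zify.

Set Implicit Arguments.
Unset Strict Implicit.
Unset Printing Implicit Defensive.

Import Order.TTheory GRing.Theory Num.Theory.
Import numFieldNormedType.Exports.

Local Open Scope classical_set_scope.
Local Open Scope ring_scope.
Local Open Scope complex_scope.

(** Expand the left-hand side as a Laurent series, the sum of c_t z^t over t.
    Merging the rising factorials of the prefactor and of the two series shows
    that the contribution of the indices (k, s - k) to the i-th summand, with
    t = s - n_i, is the residue at x = a_i - k of the rational function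
<<
      f_t(x) = prod_l (1 - b_l + x)_(m_l + t) / (x - a_l)_(n_l + t + 1).
>>
    ([residue_term]).  When t >= - m_min, the function f_t has no other poles,
    so c_t is the sum of all residues of f_t.

    Multiplying by (1 - z)^q, with q = p + 1, replaces c by its q-th backward
    difference, so it suffices that this difference vanishes at every
    t > p - m_min: the product is then a Laurent polynomial whose coefficients
    are the beta_j.  Now f_(t+1)(x) = U(x) / V(x) f_t(x + 1), where
    U = prod_l (x + 1 - b_l) and V = prod_l (x - a_l) are monic of the same
    degree.  Hence f_(t+1) - f_t, which is U / V (f_t(x+1) - f_t(x))
    + (U / V - 1) f_t, has a smaller degree at infinity than f_t, and satisfies
    the same recursion.  By induction the q-th difference of f_t has degree at
    most (M - N - r) - q <= -2, so its residues sum to zero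
    ([bdiff_laurent_coef]).

    To stay within polynomials, all the f_t of a window t, ..., t + q are put
    over the common denominator prod_l (x - a_l)_K with K large.  It has
    simple roots, the nodes a_i - k with k < K, and the numerators obey a
    recursion of the same shape ([numer_rec], [size_iter_fdiff]); the vanishing
    of the sum of residues becomes Lagrange interpolation ([lagrange_sum0]).

    On the analytic side, the coefficients of both hypergeometric series are
    O(rho^k) for every rho > 1 ([subexp_hypergeom_coef]); therefore the
    series converge for |z| < 1 and may be multiplied by the Cauchy product
    ([hypergeom_product_cvg]). *)

(** * Rising factorials *)

Section Rising.
Variable K : numFieldType.
Implicit Types (u v : K) (e f : int) (j k : nat).

Definition nonint u := forall e, u <> e%:~R.

Lemma rising0 u : rising u 0 = 1.
Proof. by change (rising u (Posz 0) = 1); rewrite /rising big_geq. Qed.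

Lemma rising_defined_nonint u e : nonint u -> rising_defined u e.
Proof. by move=> hu j _ _; exact: (hu j%:Z). Qed.

Lemma rising_definedW u e f : e <= f -> rising_defined u e -> rising_defined u f.
Proof. by move=> ef hu j j0 jf; apply: hu => //; lia. Qed.

Lemma rising_defined_nat u j : rising_defined u j%:Z.
Proof. by move=> i i0 ij; lia. Qed.

Lemma risingSr u e : rising_defined u e ->
  rising u (e + 1) = rising u e * (u + e%:~R).
Proof.
case: e => [j|j] hu.
  by rewrite -PoszD addn1 /rising big_nat_recr.
have hj : u - j.+1%:R != 0.
  by rewrite subr_eq0; apply/eqP/hu => //; lia.
rewrite {2}/rising [in RHS]big_nat_recr //= invfM NegzE intrN -mulrA.
rewrite mulVf ?mulr1 // -NegzE.
case: j hu hj => [|j] hu hj.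
  by rewrite (_ : Negz 0 + 1 = 0) ?rising0 ?big_geq ?invr1.
by have -> : Negz j.+1 + 1 = Negz j by lia.
Qed.

Lemma rising_split u e j : rising_defined u e ->
  rising u (e + j%:Z) = rising u e * rising (u + e%:~R) j%:Z.
Proof.
move=> hu; elim: j => [|j IH]; first by rewrite addr0 rising0 mulr1.
rewrite -addn1 PoszD addrA risingSr; last by apply: rising_definedW hu; lia.
by rewrite IH (risingSr (@rising_defined_nat _ _)) intrD -mulrA -addrA.
Qed.

Lemma risingSl v f : rising_defined v f ->
  rising (v - 1) (f + 1) = (v - 1) * rising v f.
Proof.
case: f => [j|j] hv.
  rewrite -PoszD addn1 /rising big_nat_recl //= addr0; congr (_ * _).
  by apply: eq_bigr => i _; rewrite -natr1; ring.
have h1 : v - 1 != 0 by rewrite subr_eq0; apply/eqP/(hv 1%N) => //; lia.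
rewrite {2}/rising big_ltn // invfM mulrA mulfV // mul1r.
case: j {hv} => [|j].
  by rewrite (_ : Negz 0 + 1 = 0) // rising0 big_geq ?invr1.
have -> : Negz j.+1 + 1 = Negz j by lia.
rewrite /rising [in RHS]big_add1 /=.
by congr (_^-1); apply: eq_bigr => i _; rewrite -natr1; ring.
Qed.

(** In the one-step case ([risingSl]) the factor v - 1 either extends the product
    or cancels the first factor of the denominator; so definedness at v carries
    over to v - 1. *)
Lemma rising_shift v f k : rising_defined v f ->
  rising (v - k%:R) (f + k%:Z) = rising (v - k%:R) k%:Z * rising v f.
Proof.
elim: k v f => [|k IH] v f hv; first by rewrite subr0 addr0 rising0 mul1r.
have hv1 : rising_defined (v - 1) (f + 1).
  move=> j j0 jf vj; apply: (hv j.+1) => //; first by lia.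
  by rewrite -natr1 -vj subrK.
have -> : v - k.+1%:R = v - 1 - k%:R by rewrite -natr1; ring.
rewrite -addn1 PoszD; have -> : f + (k%:Z + 1) = f + 1 + k%:Z by ring.
rewrite IH // risingSl // (risingSr (@rising_defined_nat _ _)) -mulrA.
by rewrite -pmulrn subrK.
Qed.

Lemma rising_reflect v k :
  rising (1 - v) k%:Z = (-1) ^+ k * rising (v - k%:R) k%:Z.
Proof.
rewrite /rising [in RHS]big_nat_rev /= add0n -(subn0 k) -prodr_const_nat subn0.
rewrite -big_split /=; apply: eq_big_nat => i ik.
by rewrite natrB //; ring.
Qed.

(** For v = 1 - b_l + a_i the three factors come from the prefactor, the second
    series and the first series; for v = a_i - a_l from their denominators.  They
    merge into the single factor of f_t at x = a_i - k. *)
Lemma rising_merge v e j k : rising_defined v e ->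
  rising v e * rising (v + e%:~R) j%:Z * rising (1 - v) k%:Z =
  (-1) ^+ k * rising (v - k%:R) (e + j%:Z + k%:Z).
Proof.
move=> hv; rewrite -rising_split // rising_reflect mulrC -mulrA.
by rewrite rising_shift //; apply: rising_definedW hv; lia.
Qed.

Lemma rising_neq0 u e : nonint u -> rising u e != 0.
Proof.
move=> hu; case: e => j; rewrite /rising ?invr_eq0 prodf_seq_neq0;
  apply/allP => i _ /=; [rewrite addr_eq0|rewrite subr_eq0]; apply/eqP => h.
  by apply: (hu (- i%:Z)); rewrite intrN.
by apply: (hu i%:Z).
Qed.
End Rising.

(** * Finite differences and degrees *)

Section Differences.

(** Forward differences are indexed by [nat]: they are applied to families of
    polynomials that only exist on a finite window.  Backward differences,
    indexed by [int], are what multiplication by 1 - z does to the coefficients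
    of a Laurent series. *)
Definition fdiff (V : zmodType) (f : nat -> V) (j : nat) : V := f j.+1 - f j.
Definition bdiff (V : zmodType) (f : int -> V) (t : int) : V := f t - f (t - 1).

Lemma iter_bdiffE (V : zmodType) (f : int -> V) q t i :
  iter q (@bdiff V) f (t + q%:Z + i%:Z) =
  iter q (@fdiff V) (fun j => f (t + j%:Z)) i.
Proof.
elim: q i => [|q IH] i; first by rewrite addr0.
rewrite /= /fdiff -!IH /bdiff.
by congr (iter q _ f _ - iter q _ f _); lia.
Qed.

Lemma eq_iter_fdiff (V : zmodType) (f g : nat -> V) q i :
  (forall j, (j <= i + q)%N -> f j = g j) ->
  iter q (@fdiff V) f i = iter q (@fdiff V) g i.
Proof.
elim: q i => [|q IH] i fg; first by apply: fg; lia.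
by rewrite /= /fdiff !IH // => j hj; apply: fg; lia.
Qed.

Lemma iter_fdiff_morph (V W : zmodType) (L : V -> W) f q i :
  {morph L : x y / x - y} ->
  L (iter q (@fdiff V) f i) = iter q (@fdiff W) (L \o f) i.
Proof. by move=> hL; elim: q i => [|q IH] i //=; rewrite /fdiff hL !IH. Qed.

Lemma size_sub_lead (K : fieldType) (p q : {poly K}) :
  size p = size q -> lead_coef p = lead_coef q ->
  (size (p - q)%R <= (size p).-1)%N.
Proof.
move=> spq lpq; apply/leq_sizeP => j hj; rewrite coefB.
have [->|nj] := eqVneq j (size p).-1.
  by move: lpq; rewrite /lead_coef -spq => ->; rewrite subrr.
have h : (size p <= j)%N by lia.
by rewrite !nth_default ?subrr // -spq.
Qed.

(** The identity (p' - p) V = U (p(X+1) - p) + (U - V) p loses one degree twice: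
    in p(X+1) - p, and in U - V because both are monic of the same degree. *)
Lemma size_fdiff_step (K : fieldType) (U V p p' : {poly K}) :
  U \is monic -> V \is monic -> size U = size V ->
  p' * V = U * (p \Po ('X + 1)) -> (size (p' - p)%R <= (size p).-1)%N.
Proof.
move=> mU mV sUV e.
have [p0|pN0] := eqVneq p 0.
  move: e; rewrite p0 comp_poly0 mulr0 => /eqP.
  by rewrite mulf_eq0 (negbTE (monic_neq0 mV)) orbF => /eqP ->; rewrite subrr size_poly0.
have [->|dN0] := eqVneq (p' - p) 0; first by rewrite size_poly0.
have sX : size ('X + 1 : {poly K}) = 2%N by rewrite -[1]opprK -polyCN size_XsubC.
have lX : lead_coef ('X + 1 : {poly K}) = 1 by rewrite -[1 in LHS]opprK -polyCN lead_coefXsubC.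
have sS : size (p \Po ('X + 1)) = size p by rewrite size_comp_poly2.
have lS : lead_coef (p \Po ('X + 1)) = lead_coef p.
  by rewrite lead_coef_comp ?sX // lX expr1n mulr1.
have e2 : (p' - p) * V = U * (p \Po ('X + 1) - p) + (U - V) * p.
  by rewrite mulrBl e; ring.
have s1 := size_sub_lead sS lS.
have s2 := size_sub_lead sUV (etrans (monicP mU) (esym (monicP mV))).
have sP : (0 < size p)%N by rewrite size_poly_gt0.
have sV : (0 < size V)%N by rewrite size_poly_gt0 monic_neq0.
have := congr1 (fun x : {poly K} => size x) e2.
rewrite size_Mmonic // => se.
have := size_polyD (U * (p \Po ('X + 1) - p)) ((U - V) * p).
have := size_polyMleq U (p \Po ('X + 1) - p).
have := size_polyMleq (U - V) p.
rewrite -se; move: s1 s2 sP sV; rewrite sS sUV.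
move: (size (_ - p)) (size (U - V)) (size p) (size V) => d x y v.
lia.
Qed.

(** The recursion is linear in [W], hence inherited by the differences of [W], so
    each difference lowers the degree by one. *)
Lemma size_iter_fdiff (K : fieldType) (U V : {poly K}) (q E : nat) (W : nat -> {poly K}) :
  U \is monic -> V \is monic -> size U = size V ->
  (forall j, (j < q)%N -> W j.+1 * V = U * (W j \Po ('X + 1))) ->
  (size (W 0%N) <= E + q)%N ->
  (size (iter q (@fdiff _) W 0%N) <= E)%N.
Proof.
move=> mU mV sUV; elim: q W => [|q IH] W hW sW; first by rewrite addn0 in sW.
rewrite iterSr; apply: IH => [j hj|].
  rewrite /fdiff mulrBl !hW ?ltnS //; last exact: ltnW.
  by rewrite comp_polyB mulrBr.
have := size_fdiff_step mU mV sUV (hW 0%N isT).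
rewrite /fdiff; move: (size _) (size _) sW => x y; lia.
Qed.

End Differences.

(** The sum is the coefficient of X^(#|I| - 1) in the Lagrange interpolation
    formula for [P].  It is also the sum of the residues of the quotient of [P] by
    the product of the X - x_i, which vanishes since the quotient has degree at
    most -2 at infinity. *)
Lemma lagrange_sum0 (K : fieldType) (I : finType) (x : I -> K) (P : {poly K}) :
  injective x -> (size P < #|I|)%N ->
  \sum_i P.[x i] / \prod_(j | j != i) (x i - x j) = 0.
Proof.
move=> xI sP.
pose w i := \prod_(j | j != i) (x i - x j).
have wN0 i : w i != 0.
  by apply/prodf_neq0 => j ji; rewrite subr_eq0 (inj_eq xI) eq_sym.
pose B i : {poly K} := \prod_(j | j != i) ('X - (x j)%:P).
have mB i : B i \is monic by apply: monic_prod => j _; exact: monicXsubC.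
have sB i : size (B i) = #|I|.
  rewrite /B size_prod => [|j _]; last by rewrite polyXsubC_eq0.
  rewrite (eq_bigr (fun=> 2%N)) => [|j _]; last by rewrite size_XsubC.
  rewrite sum_nat_const -[#|_|]/#|predC1 i| cardC1.
  by case: #|I| (leq_ltn_trans (leq0n _) sP) => // c _; lia.
have Bx i j : (B i).[x j] = if j == i then w i else 0.
  rewrite /B horner_prod; case: eqVneq => [->|ji].
    by apply: eq_bigr => l _; rewrite !hornerE.
  by rewrite (bigD1 j) //= !hornerE subrr mul0r.
have Qe : P = \sum_i (P.[x i] / w i) *: B i.
  apply/eqP; rewrite -subr_eq0; apply/negPn/negP => nz.
  have : (size (map x (enum I)) < size (P - \sum_i (P.[x i] / w i) *: B i)%R)%N.
    apply: max_poly_roots => //; last by rewrite map_inj_uniq ?enum_uniq.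
    apply/allP => _ /mapP[j _ ->]; rewrite rootE hornerD hornerN horner_sum.
    rewrite (bigD1 j) //= big1 => [|l lj]; rewrite hornerZ Bx.
      by rewrite eqxx divfK // addr0 subrr.
    by rewrite eq_sym (negbTE lj) mulr0.
  rewrite size_map -cardE ltnNge => /negP; apply.
  apply: leq_trans (size_polyD _ _) _; rewrite size_polyN geq_max (ltnW sP) /=.
  apply: leq_trans (size_sum _ _ _) _; apply/bigmax_leqP => l _.
  by rewrite -(sB l) size_scale_leq.
have := congr1 (fun p : {poly K} => p`_(#|I|.-1)) Qe.
rewrite nth_default; last by case: #|I| sP.
rewrite coef_sum => e; rewrite {}[RHS]e; apply: eq_bigr => i _.
by rewrite coefZ -(sB i) -/(lead_coef (B i)) (monicP (mB i)) mulr1.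
Qed.

(** * Rising factorials as polynomials *)

Section RisingPoly.
Variable K : numFieldType.
Implicit Types (c x : K) (N : nat).

Definition rpoly c N : {poly K} := \prod_(0 <= j < N) ('X + (c + j%:R)%:P).

Lemma XaddC_monic c : 'X + c%:P \is monic.
Proof. by rewrite -[c]opprK polyCN monicXsubC. Qed.

Lemma rpoly_monic c N : rpoly c N \is monic.
Proof. by apply: monic_prod => j _; apply: XaddC_monic. Qed.

Lemma rpolySr c N : rpoly c N.+1 = rpoly c N * ('X + (c + N%:R)%:P).
Proof. by rewrite /rpoly big_nat_recr. Qed.

Lemma rpolySl c N : rpoly c N.+1 = ('X + c%:P) * rpoly (c + 1) N.
Proof.
rewrite /rpoly big_nat_recl //= addr0; congr (_ * _).
by apply: eq_bigr => j _; rewrite -natr1 -addrA [1 + _]addrC.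
Qed.

Lemma size_rpoly c N : size (rpoly c N) = N.+1.
Proof.
elim: N => [|N IH]; first by rewrite /rpoly big_geq // size_poly1.
rewrite rpolySr size_Mmonic ?XaddC_monic ?monic_neq0 ?rpoly_monic // IH.
by rewrite -[c + _]opprK polyCN size_XsubC addn2.
Qed.

Lemma horner_rpoly c N x : (rpoly c N).[x] = rising (x + c) N%:Z.
Proof.
rewrite /rpoly /rising horner_prod; apply: eq_bigr => j _.
by rewrite !hornerE ?addrA.
Qed.

Lemma rpoly_shift c N : rpoly c N \Po ('X + 1) = rpoly (c + 1) N.
Proof.
rewrite /rpoly rmorph_prod; apply: eq_bigr => j _ /=.
by rewrite rmorphD /= comp_polyX comp_polyC -addrA -[1]/(1%:P) -polyCD addrCA addrA.
Qed.

Lemma rising_natS (i j : nat) : rising (i.+1%:R : K) j%:Z * i`!%:R = (i + j)`!%:R.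
Proof.
elim: j => [|j IH]; first by rewrite rising0 mul1r addn0.
rewrite -[j.+1]addn1 PoszD (risingSr (@rising_defined_nat _ _ _)) mulrAC IH.
by rewrite -pmulrn -natrD -natrM addn1 addnS factS mulnC addSn.
Qed.

Lemma rising_int_eq0 (k N : nat) (e : int) :
  e <= k%:Z -> k%:Z < e + N%:Z -> rising (- k%:R + e%:~R : K) N%:Z = 0.
Proof.
move=> ek kN; apply/eqP; rewrite /rising prodf_seq_eq0; apply/hasP.
exists `|k%:Z - e|%N; first by rewrite mem_index_iota; lia.
have -> : (`|k%:Z - e|%N)%:R = k%:R - e%:~R :> K.
  by rewrite pmulrn gez0_abs ?subr_ge0 // intrB -pmulrn.
by apply/eqP; ring.
Qed.

Lemma prod_ord_diff (N : nat) (k : 'I_N) :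
  \prod_(j < N | j != k) (j%:R - k%:R : K) =
  (-1) ^+ k * k`!%:R * (N.-1 - k)`!%:R.
Proof.
rewrite -(big_mkord (fun j => j != k :> nat) (fun j => j%:R - k%:R : K)).
have kN := ltn_ord k.
rewrite (big_cat_nat (n := k)) //=; last exact: ltnW.
rewrite [X in _ * X]big_ltn_cond // eqxx /=; congr (_ * _).
  transitivity (\prod_(0 <= j < k) (-1 * (k - j)%:R : K)).
    rewrite big_nat_cond [RHS]big_nat_cond; apply: eq_big => j.
      by rewrite andbT; case: (ltnP j k) => //= /ltn_eqF ->.
    by case/andP=> /andP[_ jk] _; rewrite natrB ?mulN1r ?opprB // ltnW.
  rewrite big_split /= prodr_const_nat subn0; congr (_ * _).
  rewrite big_nat_rev /= add0n fact_prod big_add1 -natr_prod; congr (_%:R).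
  by apply: eq_big_nat => j jk; lia.
transitivity (\prod_(k.+1 <= j < N) ((j - k)%:R : K)).
  rewrite big_nat_cond [RHS]big_nat_cond; apply: eq_big => j.
    by rewrite andbT; case: (ltnP k j) => //= /gtn_eqF ->; rewrite andbT.
  by case/andP=> /andP[jk _] _; rewrite natrB // ltnW.
rewrite fact_prod -natr_prod -[k.+1]add1n big_addn; congr (_%:R).
have -> : (N.-1 - k).+1 = (N - k)%N by lia.
by apply: eq_big_nat => j jk; rewrite addnK.
Qed.

End RisingPoly.

(** * The numerators over a common denominator *)

Section Core.
Variables (K : numFieldType) (r : nat) (I : finType) (x : I -> K).
Hypothesis xI : injective x.
Variables (c d : 'I_r -> K) (mu nu : 'I_r -> nat).

(** Over the denominator prod_l (x - a_l)_K, the function f_(t+j) has the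
    numerator prod_l (1 - b_l + x)_(mu_l + j) (x + d_l + j)_(nu_l - j), where
    c_l = 1 - b_l, d_l = n_l + t + 1 - a_l, mu_l = m_l + t and
    nu_l = K - n_l - t - 1.  This form needs no case distinction on the sign of
    n_l + t + 1. *)
Definition numer j : {poly K} :=
  \prod_(l < r) (rpoly (c l) (mu l + j) * rpoly (d l + j%:R) (nu l - j)).

Lemma size_numer0 : size (numer 0) = (\sum_l (mu l + nu l)).+1.
Proof.
rewrite size_prod => [|l _]; last by rewrite mulf_neq0 ?monic_neq0 ?rpoly_monic.
rewrite (eq_bigr (fun l => (mu l + nu l) + 1)%N) => [|l _].
  by rewrite big_split /= sum_nat_const muln1 -addSn addnK.
rewrite size_Mmonic ?rpoly_monic ?monic_neq0 ?rpoly_monic // !size_rpoly.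
lia.
Qed.

(** The polynomial form of the recursion from f_t(x + 1) to f_(t+1)(x).  Passing to
    the common denominator turns its factors x - a_l into x - a_l + K. *)
Lemma numer_rec j : (forall l, j < nu l)%N ->
  numer j.+1 * \prod_l ('X + (d l + (nu l)%:R)%:P) =
  \prod_l ('X + (c l)%:P) * (numer j \Po ('X + 1)).
Proof.
move=> hj; rewrite /numer rmorph_prod -!big_split /=; apply: eq_bigr => l _.
rewrite rmorphM /= !rpoly_shift addnS rpolySl -!mulrA; congr (_ * (_ * _)).
rewrite -(subnSK (hj l)) rpolySr -natr1 !addrA; congr (_ * ('X + _%:P)).
by rewrite -[in LHS](subnK (hj l)) natrD -natr1; ring.
Qed.

Lemma iter_fdiff_residue_sum q : (forall l, q <= nu l)%N ->
  (\sum_l (mu l + nu l) + 2 <= #|I| + q)%N -> (0 < #|I|)%N ->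
  iter q (@fdiff K) (fun j => \sum_i (numer j).[x i] /
      \prod_(i' | i' != i) (x i - x i')) 0 = 0.
Proof.
move=> hq hs hI.
pose L (p : {poly K}) := \sum_i p.[x i] / \prod_(i' | i' != i) (x i - x i').
have LB : {morph L : p p' / p - p'}.
  move=> p p'; rewrite /L -sumrB; apply: eq_bigr => i _.
  by rewrite hornerD hornerN mulrBl.
rewrite -[LHS](iter_fdiff_morph numer q 0 LB) /L lagrange_sum0 //.
set U := \prod_l ('X + (c l)%:P); set V := \prod_l ('X + (d l + (nu l)%:R)%:P).
have mU : U \is monic by apply: monic_prod => l _; apply: XaddC_monic.
have mV : V \is monic by apply: monic_prod => l _; apply: XaddC_monic.
have sP (e : 'I_r -> K) : size (\prod_l ('X + (e l)%:P)) = r.+1.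
  rewrite size_prod => [|l _]; last by rewrite monic_neq0 ?XaddC_monic.
  rewrite (eq_bigr (fun=> 2%N)) => [|l _].
    by rewrite sum_nat_const card_ord; lia.
  by rewrite -[e l]opprK polyCN size_XsubC.
rewrite -(ltn_predK hI) ltnS (size_iter_fdiff mU mV) ?sP //.
  by move=> j jq; apply: numer_rec => l; apply: leq_trans (hq l).
by rewrite size_numer0; lia.
Qed.
End Core.

(** * The Laurent coefficients as sums of residues *)

Arguments rising : simpl never.

Definition cauchy_conv (K : pzRingType) (u v : nat -> K) (s : nat) : K :=
  \sum_(k < s.+1) u k * v (s - k)%N.

Definition int_ext (K : nmodType) (f : nat -> K) (t : int) : K :=
  if t is Posz s then f s else 0.

Definition hypergeom_coef (K : numFieldType) (c d : seq K) (k : nat) : K :=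
  (\prod_(x <- c) rising x k) / (\prod_(y <- d) rising y k) / k`!%:R.

Section Coef.
Variables (K : numFieldType) (r : nat) (a b : 'I_r -> K) (m n : 'I_r -> int).
Hypothesis a_nonint : forall i l : 'I_r, i != l -> nonint (a i - a l).
Hypothesis hdef : forall i l : 'I_r, rising_defined (1 - b l + a i) (m l - n i).

Definition prefactor i : K :=
  (\prod_l rising (1 - b l + a i) (m l - n i)) /
  (\prod_(l | l != i) rising (a i - a l) (n l - n i + 1)).

Definition left_coef i : nat -> K :=
  hypergeom_coef [seq b l - a i | l : 'I_r] [seq 1 + a l - a i | l : 'I_r in predC1 i].

Definition right_coef i : nat -> K :=
  hypergeom_coef [seq 1 - b l + a i + (m l - n i)%:~R | l : 'I_r]
        [seq 1 - a l + a i + (n l - n i)%:~R | l : 'I_r in predC1 i].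

(** The coefficient of z^t in the left-hand side of the theorem. *)
Definition laurent_coef (t : int) : K :=
  \sum_i prefactor i * int_ext (cauchy_conv (left_coef i) (right_coef i)) (t + n i).

(** The roots of the common denominator prod_l (x - a_l)_K0. *)
Definition node K0 (p : 'I_r * 'I_K0) : K := a p.1 - p.2%:R.

Lemma node_inj K0 : injective (@node K0).
Proof.
move=> [i k] [i' k']; rewrite /node /= => e.
have [ii|ni] := eqVneq i i'; last first.
  case: (a_nonint ni (e := k%:Z - k'%:Z)).
  by rewrite intrB -!pmulrn -[a i](subrK k%:R) e; ring.
move: e; rewrite ii => /addrI/oppr_inj/eqP; rewrite eqr_nat => /eqP kk.
by congr pair; apply: val_inj.
Qed.

(** The value at a node of the derivative of the common denominator. *)
Lemma node_weight K0 (i : 'I_r) (k : 'I_K0) :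
  \prod_(p | p != (i, k)) (node (i, k) - node p) =
  (\prod_(l | l != i) rising (a i - k%:R - a l) K0%:Z) *
  ((-1) ^+ k * k`!%:R * (K0.-1 - k)`!%:R).
Proof.
rewrite -prod_ord_diff (bigID (fun p => p.1 == i)) /= mulrC; congr (_ * _).
  rewrite /rising.
  under [RHS]eq_bigr => l _ do rewrite big_mkord.
  rewrite pair_big_dep /=; apply: eq_big => [[l j]|[l j] _] /=.
    by rewrite andbT xpair_eqE; case: (l == i); rewrite ?andbF ?andbT.
  by rewrite /node /=; ring.
rewrite (reindex_onto (fun j => (i, j)) (fun p => p.2)) => [|[l j]] /=.
  by apply: eq_big => [j|j _] /=; rewrite ?xpair_eqE ?eqxx ?andbT //= /node /=; ring.
by case/andP=> _ /eqP ->.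
Qed.

(** The right-hand side is the residue at x = a_i - k of f_t written over the
    common denominator.  The signs (-1)^k produced by [rising_merge] cancel but
    for one, which is the sign of (-k)(-k+1)...(-1) in the weight of the node. *)
Lemma residue_term i (t : int) (s k K0 : nat) (mu nu : 'I_r -> nat) :
  t + n i = s%:Z -> (k <= s)%N ->
  (forall l, t + m l = (mu l)%:Z) -> (forall l, t + n l + 1 + (nu l)%:Z = K0%:Z) ->
  prefactor i * (left_coef i k * right_coef i (s - k)%N) =
  (\prod_l (rising (a i - k%:R + (1 - b l)) (mu l) *
            rising (a i - k%:R + (- a l + (t + n l + 1)%:~R)) (nu l))) /
  ((\prod_(l | l != i) rising (a i - k%:R - a l) K0%:Z) *
  ((-1) ^+ k * k`!%:R * (K0.-1 - k)`!%:R)).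
Proof.
move=> ts ks hmu hnu; rewrite /prefactor /left_coef /right_coef /hypergeom_coef.
rewrite !big_image /=.
set A0 := \prod_l _; set B0 := \prod_(l | _) _; set A1 := \prod_l _.
set B1 := \prod_(l | _) _; set A2 := \prod_l _; set B2 := \prod_(l | _) _.
have -> : A0 / B0 * (A1 / B1 / k`!%:R * (A2 / B2 / (s - k)`!%:R)) =
   (A0 * A2 * A1) / (B0 * B2 * B1) / (k`!%:R * (s - k)`!%:R).
  by rewrite !invfM; ring.
have -> : A0 * A2 * A1 = \prod_l ((-1) ^+ k * rising (a i - k%:R + (1 - b l)) (mu l)).
  rewrite -!big_split; apply: eq_bigr => l _ /=.
  have -> : b l - a i = 1 - (1 - b l + a i) by ring.
  rewrite rising_merge //; congr (_ * _); congr (rising _ _); first by ring.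
  by move: (hmu l); lia.
pose D l := rising (a i - k%:R + (- a l + (t + n l + 1)%:~R)) (nu l).
have -> : B0 * B2 * B1 = \prod_(l | l != i)
   ((-1) ^+ k * (rising (a i - k%:R - a l) K0%:Z / D l)).
  rewrite /B1 /B2.
  rewrite -!big_split; apply: eq_bigr => l li /=.
  have hal : nonint (a i - a l) by apply: a_nonint; rewrite eq_sym.
  have hk e : nonint (a i - k%:R - a l + e%:~R).
    move=> f h; apply: (hal (f - e + k%:Z)).
    by rewrite intrD intrB -h -pmulrn; ring.
  have -> : 1 + a l - a i = 1 - (a i - a l) by ring.
  have -> : 1 - a l + a i + (n l - n i)%:~R = a i - a l + (n l - n i + 1)%:~R.
    by rewrite intrD; ring.
  rewrite rising_merge; last exact: rising_defined_nonint.
  congr (_ * _).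
  have -> : n l - n i + 1 + (s - k)%N%:Z + k%:Z = t + n l + 1 by lia.
  rewrite -(hnu l) rising_split; last first.
    by apply: rising_defined_nonint; rewrite -[_ - a l]addr0; apply: (hk 0).
  rewrite /D addrA mulfK; first by congr rising; ring.
  exact/rising_neq0/hk.
rewrite !big_split /= [\prod_l rising (_ + (_ + _)) _](bigD1 i) //= -/(D i).
rewrite [\prod_l (-1) ^+ k](bigD1 i) //= prodfV.
rewrite [\prod_l rising (_ + (- _ + _)) _](bigD1 i) //= -/(D i).
have DiE : D i * (s - k)`!%:R = (K0.-1 - k)`!%:R.
  rewrite /D; have -> : a i - k%:R + (- a i + (t + n i + 1)%:~R) = (s - k).+1%:R.
    by rewrite ts -natr1 natrB // intrD -pmulrn; ring.
  by rewrite rising_natS; congr (_`!%:R); move: (hnu i); lia.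
have fN0 j : j`!%:R != 0 :> K by rewrite pnatr_eq0 -lt0n fact_gt0.
have Di0 : D i != 0.
  by apply/eqP => D0; have := fN0 (K0.-1 - k)%N; rewrite -DiE D0 mul0r eqxx.
rewrite -DiE; move: (fN0 (s - k)%N) (fN0 k).
have eE : (-1) ^- k = (-1) ^+ k :> K by rewrite -exprVn invrN1.
rewrite !invfM !invrK eE.
move: ((-1) ^+ k) (signr_eq0 K k) => e /negbT e0.
rewrite prodr_const; move: (e ^+ _) (expf_neq0 #|[pred l | l != i]| e0) => E E0.
move: (_`!%:R) (_`!%:R) => f g f0 g0.
move: (\prod_(l < r | l != i) D l) => Y.
move: (\prod_(l < r | l != i) rising _ (mu l)) => Z.
move: (\prod_(l < r | l != i) rising _ K0%:Z)^-1 => Q.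
by field; rewrite ?Di0 ?f0 ?g0 ?E0.
Qed.

(** The nodes a_i - k with k > t + n_i are not poles of f_t: its numerator over
    the common denominator vanishes there.  So the sum over all nodes is the sum
    over the poles. *)
Lemma laurent_coef_residues (t : int) (K0 : nat) (mu nu : 'I_r -> nat) :
  (forall l, t + m l = (mu l)%:Z) -> (forall l, t + n l + 1 + (nu l)%:Z = K0%:Z) ->
  laurent_coef t = \sum_(p : 'I_r * 'I_K0)
    (\prod_l (rising (node p + (1 - b l)) (mu l) *
              rising (node p + (- a l + (t + n l + 1)%:~R)) (nu l))) /
    \prod_(p' | p' != p) (node p - node p').
Proof.
move=> hmu hnu.
pose F i k := (\prod_l (rising (a i - k%:R + (1 - b l)) (mu l) *
            rising (a i - k%:R + (- a l + (t + n l + 1)%:~R)) (nu l))) /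
  ((\prod_(l | l != i) rising (a i - k%:R - a l) K0%:Z) *
  ((-1) ^+ k * k`!%:R * (K0.-1 - k)`!%:R)).
rewrite (eq_bigr (fun p : 'I_r * 'I_K0 => F p.1 p.2)) => [|[i k] _]; last by rewrite node_weight.
rewrite -(pair_bigA _ (fun i (k : 'I_K0) => F i k)) /laurent_coef /=.
apply: eq_bigr => i _.
(* [k] beyond t + n_i: the factor (x - a_i + t + n_i + 1)_(nu i) vanishes. *)
have F0 (k : nat) : (k < K0)%N -> t + n i + 1 <= k%:Z -> F i k = 0.
  move=> kK tk; rewrite /F (bigD1 i) //=.
  have -> : a i - k%:R + (- a i + (t + n i + 1)%:~R) = - k%:R + (t + n i + 1)%:~R :> K.
    by ring.
  by rewrite (@rising_int_eq0 _ k (nu i)) ?mulr0 ?mul0r // hnu.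
case e : (t + n i) => [s|s] /=; last first.
  by rewrite mulr0 big1 // => k _; apply: F0 => //; lia.
have sK : (s.+1 <= K0)%N by move: (hnu i); lia.
rewrite -(big_mkord xpredT (fun k => F i k)) (big_cat_nat (n := s.+1)) //=.
rewrite [X in _ + X]big_nat [X in _ + X]big1 ?addr0; last first.
  by move=> k /andP[sk kK]; apply: F0 => //; lia.
rewrite big_mkord /cauchy_conv mulr_sumr; apply: eq_bigr => k _.
by rewrite (residue_term e (ltn_ord k : (k <= s)%N) hmu hnu).
Qed.

Lemma bdiff_laurent_coef (t : int) (q : nat) : (0 < r)%N ->
  (forall l, 0 <= t + m l) -> \sum_l m l - \sum_l n l - r%:Z + 2 <= q%:Z ->
  iter q (@bdiff K) laurent_coef (t + q%:Z) = 0.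
Proof.
move=> r0 hm hq; rewrite -[_ + q%:Z]addr0 (iter_bdiffE _ _ _ 0%N).
(* Large enough for the exponents nu_l - j to be nonnegative on the window. *)
pose K0 := (\sum_l `|n l| + `|t| + q + 2)%N.
have nK l : (`|n l| <= \sum_l `|n l|)%N by rewrite (bigD1 l) //= leq_addr.
pose mu l := absz (t + m l).
pose nu l := absz (K0%:Z - (t + n l + 1))%R.
have hmu l : (mu l)%:Z = t + m l by rewrite gez0_abs.
have hnu l : (nu l)%:Z = K0%:Z - (t + n l + 1).
  by rewrite gez0_abs //; move: (nK l); rewrite /K0; lia.
have hnq l : (q <= nu l)%N.
  by move: (hnu l) (nK l); rewrite /K0; lia.
rewrite -[RHS](iter_fdiff_residue_sum (@node_inj K0) (fun l => 1 - b l)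
  (fun l => - a l + (t + n l + 1)%:~R) (mu := mu) (nu := nu) (q := q)) //.
- apply: eq_iter_fdiff => j jq.
  rewrite (@laurent_coef_residues _ K0 (fun l => mu l + j)%N (fun l => nu l - j)%N).
  + apply: eq_bigr => p _; congr (_ / _).
    rewrite /numer horner_prod; apply: eq_bigr => l _.
    rewrite hornerM !horner_rpoly; congr (_ * rising (_ + _) _).
    by rewrite !intrD -pmulrn; ring.
  + by move=> l; rewrite PoszD hmu; lia.
  + by move=> l; move: (hnq l) (hnu l); lia.
- rewrite card_prod !card_ord -lez_nat !PoszD.
  rewrite -[(\sum_l _)%N%:Z]natz natr_sum.
  rewrite (eq_bigr (fun l => m l - n l + (K0%:Z - 1))) => [|l _]; last first.
    by rewrite natz PoszD hmu hnu; ring.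
  rewrite big_split /= sumrB sumr_const card_ord PoszM -mulr_natl natz.
  by move: (\sum_l m l) (\sum_l n l) hq => M N; lia.
- by rewrite card_prod !card_ord muln_gt0 r0 /K0; lia.
Qed.

End Coef.

(** * Convergence of complex series *)

Section Modulus.
Variable R : realType.
Local Notation C := (complex R : numFieldType).
Implicit Types x y : R[i].

(** The norm of [R[i]] takes values in [R[i]]; estimates are made in [R]. *)
Definition modulus x : R := complex.Re `|x|.

Lemma modulusE x : `|x| = (modulus x)%:C.
Proof. by []. Qed.

Lemma modulus_ge0 x : 0 <= modulus x.
Proof. by rewrite -lecR -modulusE normr_ge0. Qed.

Lemma modulusM x y : modulus (x * y) = modulus x * modulus y.
Proof. by apply: complexI; rewrite rmorphM /= -!modulusE normrM. Qed.

Lemma modulusD x y : modulus (x + y) <= modulus x + modulus y.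
Proof. by rewrite -lecR rmorphD /= -!modulusE ler_normD. Qed.

Lemma modulusN x : modulus (- x) = modulus x.
Proof. by rewrite /modulus normrN. Qed.

Lemma modulus0 : modulus 0 = 0.
Proof. by rewrite /modulus normr0. Qed.

Lemma modulusX x k : modulus (x ^+ k) = modulus x ^+ k.
Proof. by apply: complexI; rewrite rmorphXn /= -!modulusE normrX. Qed.

Lemma modulusV x : modulus x^-1 = (modulus x)^-1.
Proof. by apply: complexI; rewrite fmorphV /= -!modulusE normfV. Qed.

Lemma modulus_nat k : modulus k%:R = k%:R.
Proof. by apply: complexI; rewrite rmorph_nat /= -!modulusE normr_nat. Qed.

Lemma modulus_eq0 x : (modulus x == 0) = (x == 0).
Proof. by rewrite -(inj_eq (@complexI R)) -modulusE normr_eq0. Qed.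

Lemma modulus_sum (I : Type) (s : seq I) (P : pred I) (F : I -> R[i]) :
  modulus (\sum_(i <- s | P i) F i) <= \sum_(i <- s | P i) modulus (F i).
Proof.
elim/big_rec2: _ => [|i y x _ xy]; first by rewrite modulus0.
by apply: le_trans (modulusD _ _) _; rewrite lerD2l.
Qed.

Lemma modulus_Re x : `|complex.Re x| <= modulus x.
Proof. by rewrite -lecR -modulusE normc_ge_Re. Qed.

Lemma modulus_Im x : `|complex.Im x| <= modulus x.
Proof.
have := modulus_Re (x * 'i%C); rewrite ReiNIm normrN modulusM.
by rewrite [modulus 'i%C]/modulus normc_def /= expr0n expr1n add0r sqrtr1 mulr1.
Qed.

Lemma modulus_le x : modulus x <= `|complex.Re x| + `|complex.Im x|.
Proof.
rewrite [in modulus x](complexE x); apply: le_trans (modulusD _ _) _.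
rewrite modulusM; have -> : modulus 'i%C = 1 :> R.
  by rewrite /modulus normc_def /= expr0n expr1n add0r sqrtr1.
rewrite mul1r lerD // /modulus normc_def /= expr0n /= addr0 sqrtr_sqr //.
Qed.

Lemma cvg_modulus (u : nat -> C) (l : C) :
  (fun k => modulus (l - u k)) @ \oo --> (0 : R) -> u @ \oo --> l.
Proof.
move=> h; apply/cvgrPdist_lt => e e0.
have [e1 e2] : e = (complex.Re e)%:C /\ 0 < complex.Re e.
  by rewrite RRe_real ?gtr0_real //; split=> //; rewrite -ltcR RRe_real ?gtr0_real.
have /cvgr0Pnorm_lt/(_ _ e2) := h; apply: filterS => k.
by rewrite ger0_norm ?modulus_ge0 // modulusE {2}e1 ltcR.
Qed.

End Modulus.

Section Series.
Variable R : realType.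
Local Notation C := (complex R : numFieldType).
Implicit Types (u v : nat -> C) (s B : R).

Lemma real_series_cvg (u : nat -> R) s B : 0 <= s -> s < 1 ->
  (forall k, `|u k| <= B * s ^+ k) -> cvgn (series u).
Proof.
move=> s0 s1 hu; apply: (@normed_cvg R R^o).
apply: (@series_le_cvg R _ (geometric B s)) => //.
- by move=> k /=; exact: normr_ge0.
- by move=> k /=; apply: le_trans (normr_ge0 _) (hu k).
- by apply: is_cvg_geometric_series; rewrite ger0_norm.
Qed.

Lemma complex_series_cvg u s B : 0 <= s -> s < 1 ->
  (forall k, modulus (u k) <= B * s ^+ k) -> exists l : C, series u @ \oo --> l.
Proof.
move=> s0 s1 hu.
have /cvg_ex[x /= hx] : cvgn (series (fun k => complex.Re (u k))).
  by apply: (real_series_cvg s0 s1) => k; apply: le_trans (modulus_Re _) (hu k).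
have /cvg_ex[y /= hy] : cvgn (series (fun k => complex.Im (u k))).
  by apply: (real_series_cvg s0 s1) => k; apply: le_trans (modulus_Im _) (hu k).
exists (x +i* y)%C; apply: cvg_modulus.
have ReS n : complex.Re (series u n) = series (fun k => complex.Re (u k)) n.
  by rewrite /series /= (big_morph (@complex.Re R) (op1 := +%R) (id1 := 0)) // => -[? ?] [? ?].
have ImS n : complex.Im (series u n) = series (fun k => complex.Im (u k)) n.
  by rewrite /series /= (big_morph (@complex.Im R) (op1 := +%R) (id1 := 0)) // => -[? ?] [? ?].
apply: (@squeeze_cvgr _ _ _ _ (cst 0) (fun n => `|x - series (fun k => complex.Re (u k)) n| + `|y - series (fun k => complex.Im (u k)) n|)).
- near=> n; rewrite modulus_ge0 /=; apply: le_trans (modulus_le _) _.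
  by rewrite -ReS -ImS; case: (series u n).
- exact: cvg_cst.
- rewrite -[X in _ --> X]addr0; apply: cvgD.
    by rewrite -(@normr0 _ R) -(subrr x); apply: cvg_norm; apply: cvgB => //; apply: cvg_cst.
  by rewrite -(@normr0 _ R) -(subrr y); apply: cvg_norm; apply: cvgB => //; apply: cvg_cst.
Unshelve. all: by end_near.
Qed.

(** Grouping by the index of [u]: the partial sums of the Cauchy product are
    triangular double sums. *)
Lemma series_cauchy_conv u v n :
  series (cauchy_conv u v) n = \sum_(i < n) u i * series v (n - i)%N.
Proof.
elim: n => [|n IH]; first by rewrite /series /= big_geq // big_ord0.
rewrite seriesSr IH /cauchy_conv.
rewrite [in RHS]big_ord_recr /= [X in _ + X]big_ord_recr /= addrA -big_split /=.
congr (_ + _); last by rewrite subSnn subnn /series /= big_nat1.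
apply: eq_bigr => i _; rewrite -mulrDr subSn; last exact: ltnW.
by rewrite seriesSr.
Qed.

Lemma geometric_tail v s B m n : 0 <= s -> s < 1 -> 0 <= B ->
  (forall k, modulus (v k) <= B * s ^+ k) -> (m <= n)%N ->
  modulus (series v n - series v m) <= B / (1 - s) * s ^+ m.
Proof.
move=> s0 s1 B0 hv mn; have s1' : 0 < 1 - s by rewrite subr_gt0.
rewrite /series /= (big_cat_nat (n := m)) //= addrAC subrr add0r.
apply: le_trans (modulus_sum _ _ _) _.
suff: \sum_(m <= k < n) modulus (v k) <= B / (1 - s) * (s ^+ m - s ^+ n).
  move=> h; apply: le_trans h _; rewrite ler_wpM2l ?divr_ge0 ?(ltW s1') //.
  by rewrite gerBl exprn_ge0.
elim: n mn => [|n IH]; first by rewrite leqn0 => /eqP ->; rewrite big_geq // subrr mulr0.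
rewrite leq_eqVlt => /predU1P[->|mn]; first by rewrite big_geq // subrr mulr0.
rewrite big_nat_recr //=; apply: le_trans (lerD (IH mn) (hv n)) _.
rewrite exprS le_eqVlt; apply/orP; left; apply/eqP; field.
by rewrite gt_eqF.
Qed.

Lemma cvgM_error (K : numFieldType) (f g h : nat -> K) (U V : K) :
  f @ \oo --> U -> g @ \oo --> V -> (fun n => f n * g n - h n) @ \oo --> (0 : K) ->
  h @ \oo --> U * V.
Proof.
move=> fU gV fgh.
have -> : h = (fun n => f n * g n - (f n * g n - h n)).
  by apply/funext => n; rewrite subKr.
by rewrite -[X in _ --> X]subr0; apply: cvgB => //; exact: cvgM.
Qed.

(** The error between the square and the triangular double sums is the sum of
    the u_i (V_n - V_(n-i)), V_n being the partial sums of [v].  With ratio s^2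
    for [u] and s for the tail of [v], each term is at most a constant times
    s^(2i) s^(n-i) = s^n s^i, so the error is O(s^n). *)
Lemma cauchy_product u v (U V : C) s B B' : 0 <= s -> s < 1 ->
  (forall k, modulus (u k) <= B * (s ^+ 2) ^+ k) ->
  (forall k, modulus (v k) <= B' * (s ^+ 2) ^+ k) ->
  series u @ \oo --> U -> series v @ \oo --> V ->
  series (cauchy_conv u v) @ \oo --> U * V.
Proof.
move=> s0 s1 hu hv cu cv.
have s1' : 0 < 1 - s by rewrite subr_gt0.
have B0 : 0 <= B by have := hu 0%N; rewrite expr0 mulr1; apply: le_trans; apply: modulus_ge0.
have B'0 : 0 <= B' by have := hv 0%N; rewrite expr0 mulr1; apply: le_trans; apply: modulus_ge0.
have ss k : (s ^+ 2) ^+ k <= s ^+ k.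
  rewrite -exprM mul2n -addnn exprD ler_piMr ?exprn_ge0 //.
  by rewrite exprn_ile1 // ltW.
have hv' k : modulus (v k) <= B' * s ^+ k.
  by apply: le_trans (hv k) _; rewrite ler_wpM2l.
pose D := B / (1 - s) * (B' / (1 - s)).
have key n : modulus (series u n * series v n - series (cauchy_conv u v) n) <= D * s ^+ n.
  rewrite series_cauchy_conv {1}/series /= big_mkord mulr_suml -sumrB.
  apply: le_trans (modulus_sum _ _ _) _.
  apply: (@le_trans _ _ (\sum_(i < n) (B * (B' / (1 - s)) * s ^+ n) * s ^+ i)).
    apply: ler_sum => i _; rewrite -mulrBr modulusM.
    have tl := geometric_tail s0 s1 B'0 hv' (leq_subr i n).
    apply: le_trans (ler_pM (modulus_ge0 _) (modulus_ge0 _) (hu i) tl) _.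
    rewrite le_eqVlt; apply/orP; left; apply/eqP.
    rewrite -[in s ^+ n](subnK (ltnW (ltn_ord i))) exprD -exprM mul2n -addnn exprD.
    by ring.
  rewrite -mulr_sumr.
  have gs : \sum_(i < n) s ^+ i <= (1 - s)^-1.
    rewrite -(ler_pM2l s1') divff ?gt_eqF // -opprB mulNr -subrX1 opprB.
    by rewrite gerBl exprn_ge0.
  have -> : D * s ^+ n = (B * (B' / (1 - s)) * s ^+ n) * (1 - s)^-1 by rewrite /D; ring.
  by rewrite ler_wpM2l // !mulr_ge0 ?exprn_ge0 // invr_ge0 ltW.
apply: (cvgM_error cu cv).
apply: cvg_modulus.
apply: (@squeeze_cvgr _ _ _ _ (cst 0) (geometric D s)).
- by near=> n; rewrite modulus_ge0 /= sub0r modulusN key.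
- exact: cvg_cst.
- by apply: cvg_geometric; rewrite ger0_norm.
Unshelve. all: by end_near.
Qed.

End Series.

(** * Growth of hypergeometric coefficients *)

Section Growth.
Variable R : realType.

(** The power series with coefficients [w] has radius of convergence at least 1.
    Unlike a bound on successive ratios, this is preserved by products even when
    some factors vanish. *)
Definition subexponential (w : nat -> R[i]) :=
  forall rho : R, 1 < rho -> exists B : R, forall k, modulus (w k) <= B * rho ^+ k.

Lemma subexp_ratio (w : nat -> R[i]) :
  (forall rho : R, 1 < rho -> exists k0, forall k, (k0 <= k)%N ->
     modulus (w k.+1) <= rho * modulus (w k)) -> subexponential w.
Proof.
move=> hw rho rho1; have [k0 hk0] := hw rho rho1.
have r0 : 0 < rho by apply: lt_trans rho1.
exists (\sum_(k < k0.+1) modulus (w k)).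
have small k : (k <= k0)%N ->
    modulus (w k) <= (\sum_(k < k0.+1) modulus (w k)) * rho ^+ k.
  move=> kk0; apply: (@le_trans _ _ (\sum_(k < k0.+1) modulus (w k))).
    rewrite (bigD1 (Ordinal (kk0 : (k < k0.+1)%N))) //= lerDl.
    by apply: sumr_ge0 => *; apply: modulus_ge0.
  apply: ler_peMr; last by rewrite exprn_ege1 // ltW.
  by apply: sumr_ge0 => *; apply: modulus_ge0.
elim=> [|k IH]; first exact: small.
have [kk0|kk0] := leqP k0 k; last exact: small.
apply: le_trans (hk0 k kk0) _.
by rewrite exprS mulrCA ler_pM2l.
Qed.

Lemma subexpM (w w' : nat -> R[i]) :
  subexponential w -> subexponential w' -> subexponential (fun k => w k * w' k).
Proof.
move=> hw hw' rho rho1.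
have s1 : 1 < Num.sqrt rho by rewrite -sqrtr1 ltr_sqrt // (lt_trans ltr01).
have [B hB] := hw _ s1; have [B' hB'] := hw' _ s1.
exists (B * B') => k; rewrite modulusM.
apply: le_trans (ler_pM (modulus_ge0 _) (modulus_ge0 _) (hB k) (hB' k)) _.
by rewrite mulrACA -exprMn -expr2 sqr_sqrtr // ltW // (lt_trans ltr01).
Qed.

Lemma subexp_prod (T : eqType) (s : seq T) (w : T -> nat -> R[i]) :
  (forall x, x \in s -> subexponential (w x)) ->
  subexponential (fun k => \prod_(x <- s) w x k).
Proof.
elim: s => [|x s IH] hs.
  move=> rho rho1; exists 1 => k; rewrite big_nil mul1r -[1]/(1%:R) modulus_nat.
  by rewrite exprn_ege1 // ltW.
have -> : (fun k => \prod_(y <- x :: s) w y k) = (fun k => w x k * \prod_(y <- s) w y k).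
  by apply/funext => k; rewrite big_cons.
apply: subexpM; first by apply: hs; rewrite mem_head.
by apply: IH => y ys; apply: hs; rewrite inE ys orbT.
Qed.

Lemma modulusB_ge (x y : R[i]) : modulus y - modulus x <= modulus (x + y).
Proof.
rewrite lerBlDr; have -> : modulus y = modulus (x + y - x) by congr modulus; ring.
by apply: le_trans (modulusD _ _) _; rewrite modulusN.
Qed.

Lemma natS_modulus k : modulus (k.+1%:R : R[i]) = k%:R + 1.
Proof. by rewrite modulus_nat -natr1. Qed.

Lemma rising_ratio (c : R[i]) k : 
  rising c k.+1%:Z / (k.+1)`!%:R = rising c k%:Z / k`!%:R * ((c + k%:R) / k.+1%:R).
Proof.
rewrite -[k.+1 in LHS]addn1 PoszD (risingSr (@rising_defined_nat _ _ _)) -pmulrn.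
by rewrite addn1 factS natrM !invfM; ring.
Qed.

Lemma subexp_rising (c : R[i]) :
  subexponential (fun k => rising c k%:Z / k`!%:R).
Proof.
apply: subexp_ratio => rho rho1.
have rp : 0 < rho - 1 by rewrite subr_gt0.
exists (Num.bound (modulus c / (rho - 1))) => k hk.
rewrite rising_ratio modulusM mulrC ler_wpM2r ?modulus_ge0 //.
rewrite modulusM modulusV natS_modulus ler_pdivrMr ?ltr_wpDl //.
apply: le_trans (modulusD _ _) _; rewrite modulus_nat.
have : modulus c / (rho - 1) <= k%:R.
  apply: le_trans (ltW (archi_boundP _)) _; last by rewrite ler_nat.
  by rewrite divr_ge0 ?modulus_ge0 // ltW.
by rewrite ler_pdivrMr // => h; lra.
Qed.

Lemma subexp_rising_inv (d : R[i]) : nonint d ->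
  subexponential (fun k => k`!%:R / rising d k%:Z).
Proof.
move=> hd; apply: subexp_ratio => rho rho1.
have rp : 0 < rho - 1 by rewrite subr_gt0.
exists (Num.bound ((1 + rho * modulus d) / (rho - 1))) => k hk.
rewrite -[_ / rising d k.+1%:Z]invf_div -[_ / rising d k%:Z]invf_div rising_ratio.
rewrite invfM modulusM mulrC ler_wpM2r ?modulus_ge0 //.
have dk : 0 < modulus (d + k%:R).
  rewrite lt_def modulus_ge0 modulus_eq0 andbT addr_eq0; apply/eqP => h.
  by apply: (hd (- k%:Z)); rewrite intrN -pmulrn.
rewrite invf_div modulusM modulusV natS_modulus ler_pdivrMr //.
have rho0 : 0 < rho by apply: lt_trans rho1.
have := modulusB_ge d k%:R; rewrite modulus_nat -(ler_pM2l rho0).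
apply: le_trans.
have : (1 + rho * modulus d) / (rho - 1) <= k%:R.
  apply: le_trans (ltW (archi_boundP _)) _; last by rewrite ler_nat.
  by rewrite divr_ge0 ?(ltW rp) // addr_ge0 // mulr_ge0 ?modulus_ge0 // ltW.
by rewrite ler_pdivrMr // => h; lra.
Qed.

(** As there is one more upper parameter than lower ones, and a further k! in the
    denominator, each rising factorial can be paired with a k!. *)
Lemma subexp_hypergeom_coef (c d : seq R[i]) : size c = (size d).+1 ->
  (forall x, x \in d -> nonint x) -> subexponential (hypergeom_coef c d).
Proof.
move=> scd hd.
have -> : hypergeom_coef c d = (fun k => (\prod_(x <- c) (rising x k / k`!%:R)) *
                                \prod_(x <- d) (k`!%:R / rising x k)).
  apply/funext => k; rewrite /hypergeom_coef !big_split /= !prodfV !big_const_seq !count_predT.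
  have f0 : k`!%:R != 0 :> R[i] by rewrite pnatr_eq0 -lt0n fact_gt0.
  rewrite !iter_mulr_1 scd exprS.
  have := expf_neq0 (size d) f0.
  move: (_ ^+ size d) => F F0.
  move: (\prod_(x <- c) _) (\prod_(x <- d) _)^-1 => P Q.
  by field; rewrite F0 f0.
apply: subexpM; apply: subexp_prod => x xs; first exact: subexp_rising.
by apply: subexp_rising_inv; apply: hd.
Qed.

End Growth.

(** * Multiplying a Laurent series by a power of 1 - z *)

Section Laurent.
Variable K : numFieldType.
Implicit Types (f : nat -> K) (c : int -> K) (z G : K).

(** When c vanishes below -N, these are the terms of z^N times the Laurent series
    with coefficients c; the factor z^N makes it a power series. *)
Definition laurent_term c (N : int) z k : K := c (k%:Z - N) * z ^+ k.

Lemma cvg_int_ext f z G (N e : int) (dlt : nat) : N - e = dlt%:Z ->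
  series (fun k => f k * z ^+ k) @ \oo --> G ->
  series (laurent_term (fun t => int_ext f (t + e)) N z) @ \oo --> z ^+ dlt * G.
Proof.
move=> Ne hf; rewrite -(cvg_shiftn dlt) /=.
have -> : (fun n => series (laurent_term (fun t => int_ext f (t + e)) N z) (n + dlt)%N) =
          (fun n => z ^+ dlt * series (fun k => f k * z ^+ k) n).
  apply/funext => n; rewrite /series /= (big_cat_nat (n := dlt)) ?leq_addl //=.
  rewrite big_nat big1 ?add0r => [|k /andP[_ kd]]; last first.
    rewrite /laurent_term; have : k%:Z - N + e < 0 by lia.
    by case: (k%:Z - N + e) => //= ? _; rewrite mul0r.
  rewrite -{1}[dlt]add0n big_addn addnK mulr_sumr; apply: eq_bigr => k _.
  rewrite /laurent_term exprD.
  have -> : (k + dlt)%N%:Z - N + e = k%:Z by lia.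
  by rewrite /=; ring.
by apply: cvgM => //; exact: cvg_cst.
Qed.

Lemma cvg_bdiff c N z G : (forall t, t < - N -> c t = 0) ->
  series (laurent_term c N z) @ \oo --> G ->
  series (laurent_term (@bdiff K c) N z) @ \oo --> (1 - z) * G.
Proof.
move=> c0 hc; rewrite -(cvg_shiftn 1).
have -> : (fun n => series (laurent_term (@bdiff K c) N z) (n + 1)%N) =
   (fun n => series (laurent_term c N z) (n + 1)%N - z * series (laurent_term c N z) n).
  apply/funext => n; rewrite addn1; elim: n => [|n IH].
    rewrite /series /= !big_nat1 big_geq // mulr0 subr0 /laurent_term /bdiff.
    by rewrite (c0 (0%N%:Z - N - 1)) ?subr0 //; lia.
  rewrite seriesSr IH [in RHS]seriesSr [in X in _ = _ - z * X]seriesSr.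
  rewrite /laurent_term /bdiff (_ : n.+1%:Z - N - 1 = n%:Z - N); last by lia.
  by rewrite exprS; ring.
rewrite mulrBl mul1r; apply: cvgB; first by rewrite cvg_shiftn.
by apply: cvgM => //; exact: cvg_cst.
Qed.

Lemma iter_bdiff_lt c N q : (forall t, t < N -> c t = 0) ->
  forall t, t < N -> iter q (@bdiff K) c t = 0.
Proof.
move=> c0; elim: q => [|q IH] t tN /=; first exact: c0.
by rewrite /bdiff !IH ?subrr //; lia.
Qed.

Lemma cvg_iter_bdiff c N z G q : (forall t, t < - N -> c t = 0) ->
  series (laurent_term c N z) @ \oo --> G ->
  series (laurent_term (iter q (@bdiff K) c) N z) @ \oo --> (1 - z) ^+ q * G.
Proof.
move=> c0 hc; elim: q => [|q IH]; first by rewrite mul1r.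
rewrite exprS -mulrA; apply: cvg_bdiff => //.
exact: iter_bdiff_lt.
Qed.

Lemma cvg_finite_series f n G : (forall k, (n <= k)%N -> f k = 0) ->
  series f @ \oo --> G -> G = \sum_(0 <= k < n) f k.
Proof.
move=> f0 hf; have hK : hausdorff_space K by exact: norm_hausdorff.
suff : series f @ \oo --> \sum_(0 <= k < n) f k by exact: cvg_unique.
rewrite -(cvg_shiftn n).
have -> : (fun k => series f (k + n)%N) = (fun=> \sum_(0 <= k < n) f k).
  apply/funext => k; rewrite /series /= (big_cat_nat (n := n)) ?leq_addl //=.
  by rewrite [X in _ + X]big_nat [X in _ + X]big1 ?addr0 // => j /andP[nj _]; apply: f0.
exact: cvg_cst.
Qed.

Lemma hypergeomE (c d : seq K) z G :
  series (fun k => hypergeom_coef c d k * z ^+ k) @ \oo --> G -> hypergeom c d z = G.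
Proof.
move=> h; rewrite /hypergeom.
have -> : (fun k : nat => (\prod_(x <- c) rising x k) / (\prod_(y <- d) rising y k) *
   (z ^+ k / k`!%:R)) = (fun k => hypergeom_coef c d k * z ^+ k).
  by apply/funext => k; rewrite /hypergeom_coef; ring.
by apply: cvg_lim => //; exact: norm_hausdorff.
Qed.

Lemma cauchy_conv_pow f g z : cauchy_conv (fun k => f k * z ^+ k) (fun k => g k * z ^+ k) =
  (fun k => cauchy_conv f g k * z ^+ k).
Proof.
apply/funext => k; rewrite /cauchy_conv mulr_suml; apply: eq_bigr => i _.
rewrite -[in X in _ = _ * X](subnKC (ltn_ord i : (i <= k)%N)) exprD; ring.
Qed.

Lemma cvg_series_sum (I : finType) (F : I -> nat -> K) (G : I -> K) :
  (forall i, series (F i) @ \oo --> G i) ->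
  series (fun k => \sum_i F i k) @ \oo --> \sum_i G i.
Proof.
move=> h.
have -> : series (fun k => \sum_i F i k) = (fun n => \sum_i series (F i) n).
  by apply/funext => n; rewrite /series /= exchange_big.
elim: (index_enum I) => [|i s IH].
  under eq_fun do rewrite big_nil.
  by rewrite big_nil; exact: cvg_cst.
under eq_fun do rewrite big_cons.
by rewrite big_cons; apply: cvgD.
Qed.

Lemma cvg_seriesM (x : K) f G : series f @ \oo --> G ->
  series (fun k => x * f k) @ \oo --> x * G.
Proof.
move=> h; have -> : series (fun k => x * f k) = (fun n => x * series f n).
  by apply/funext => n; rewrite /series /= mulr_sumr.
by apply: cvgM => //; exact: cvg_cst.
Qed.

End Laurent.

(** * The main identity *)

Section Main.
Variable R : realType.
Local Notation C := (complex R : numFieldType).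

Lemma hypergeom_product_cvg (c d c' d' : seq C) (z : C) :
  size c = (size d).+1 -> size c' = (size d').+1 ->
  (forall x, x \in d -> nonint x) -> (forall x, x \in d' -> nonint x) ->
  0 < `|z| < 1 ->
  series (fun k => cauchy_conv (hypergeom_coef c d) (hypergeom_coef c' d') k * z ^+ k) @ \oo -->
    hypergeom c d z * hypergeom c' d' z.
Proof.
move=> scd scd' hd hd' /andP[z0 z1].
have x0 : 0 < modulus z by rewrite -ltcR.
have x1 : modulus z < 1 by rewrite -ltcR.
(* By the arithmetic-geometric mean inequality |z| < s^2 < 1, which leaves room
   for a growth rate rho = s^2 / |z| > 1 of the coefficients. *)
pose s := (1 + modulus z) / 2.
have s0 : 0 <= s by rewrite /s; lra.
have s1 : s < 1 by rewrite /s; lra.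
have s21 : s ^+ 2 < 1 by rewrite exprn_ilt1.
have rho1 : 1 < s ^+ 2 / modulus z.
  rewrite ltr_pdivlMr // mul1r -subr_gt0.
  have -> : s ^+ 2 - modulus z = ((1 - modulus z) / 2) ^+ 2 by rewrite /s; field.
  by rewrite exprn_gt0 // divr_gt0 // subr_gt0.
have bound e f : size e = (size f).+1 -> (forall x, x \in f -> nonint x) ->
    exists B, forall k, modulus (hypergeom_coef e f k * z ^+ k) <= B * (s ^+ 2) ^+ k.
  move=> sef hf; have [B hB] := subexp_hypergeom_coef sef hf rho1; exists B => k.
  rewrite modulusM modulusX.
  apply: le_trans (ler_wpM2r _ (hB k)) _; first by rewrite exprn_ge0 ?modulus_ge0.
  by rewrite -mulrA -exprMn divfK // gt_eqF.
have [B hB] := bound _ _ scd hd; have [B' hB'] := bound _ _ scd' hd'.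
have [U hU] := complex_series_cvg (exprn_ge0 2 s0) s21 hB.
have [V hV] := complex_series_cvg (exprn_ge0 2 s0) s21 hB'.
rewrite (hypergeomE hU) (hypergeomE hV) -cauchy_conv_pow.
exact: cauchy_product s0 s1 hB hB' hU hV.
Qed.

End Main.

Theorem theorem1 (R : realType) (r : nat) (hr : (2 <= r)%N)
    (a b : 'I_r -> R[i]) (m n : 'I_r -> int)
    (a_distinct : forall i l : 'I_r, i != l ->
       forall k : int, a i - a l <> k%:~R)
    (factors_defined : forall i l : 'I_r,
       rising_defined (1 - b l + a i) (m l - n i)) :
  let i0 : 'I_r := Ordinal (ltnW hr) in
  let M : int := \sum_(i < r) m i in
  let N : int := \sum_(i < r) n i in
  let mmin : int := \big[Num.min/m i0]_(i < r) m i in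
  let nmax : int := \big[Num.max/n i0]_(i < r) n i in
  let p : int := Num.max (- 1) (M - N - r%:Z + 1) in
  exists beta : int -> R[i], forall z : R[i], 0 < `|z| < 1 ->
    \sum_(i < r)
      (\prod_(l < r) rising (1 - b l + a i) (m l - n i)) * z ^ (- n i)
      / (\prod_(l < r | l != i) rising (a i - a l) (n l - n i + 1))
      * hypergeom [seq b l - a i | l : 'I_r]
                  [seq 1 + a l - a i | l : 'I_r in predC1 i] z
      * hypergeom [seq 1 - b l + a i + (m l - n i)%:~R | l : 'I_r]
                  [seq 1 - a l + a i + (n l - n i)%:~R | l : 'I_r in predC1 i] z
    = (1 - z) ^ (- p - 1)
      * \sum_(j \in [set j : int | - nmax <= j <= p - mmin]) (beta j * z ^ j).
Proof.
move=> i0 M N mmin nmax p.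
have p1 : 0 <= p + 1 by rewrite /p; lia.
pose q := absz (p + 1).
have qE : q%:Z = p + 1 by rewrite gez0_abs.
have nmaxP i : n i <= nmax by apply: le_bigmax.
have mminP i : mmin <= m i by apply: bigmin_le_cond.
pose c : int -> R[i] := laurent_coef a b m n.
have c0 t : t < - nmax -> c t = 0.
  move=> tn; rewrite /c /laurent_coef big1 // => i _.
  have : t + n i < 0 by have := nmaxP i; lia.
  by case: (t + n i) => //= *; rewrite mulr0.
have cq t : p - mmin < t -> iter q (@bdiff _) c t = 0.
  move=> pt; rewrite -[t](subrK q%:Z); apply: bdiff_laurent_coef => //.
  - exact: ltnW.
  - by move=> l; have := mminP l; lia.
  - by rewrite qE /p -/M -/N; lia.
exists (iter q (@bdiff _) c) => z hz.
have z0 : z != 0 by case/andP: hz; rewrite normr_gt0.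
have z1 : 1 - z != 0.
  by rewrite subr_eq0; apply/eqP => e; case/andP: hz => _; rewrite -e normr1 ltxx.
set S := \sum_(i < r) _.
have cS : series (laurent_term c nmax z) @ \oo --> (z ^ nmax * S : (complex R : numFieldType)).
  pose H i := hypergeom [seq b l - a i | l : 'I_r]
                  [seq 1 + a l - a i | l : 'I_r in predC1 i] z
      * hypergeom [seq 1 - b l + a i + (m l - n i)%:~R | l : 'I_r]
                  [seq 1 - a l + a i + (n l - n i)%:~R | l : 'I_r in predC1 i] z.
  have -> : z ^ nmax * S = \sum_i prefactor a b m n i * (z ^+ absz (nmax - n i) * H i).
    rewrite mulr_sumr; apply: eq_bigr => i _.
    have -> : z ^+ absz (nmax - n i) = z ^ nmax * z ^ (- n i).
      rewrite -expfzDr // -{2}[nmax - n i]gez0_abs //.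
      by rewrite subr_ge0.
    rewrite /prefactor /H; move: (hypergeom _ _ _) (hypergeom _ _ _) => h h'.
    move: (\prod_l _) (\prod_(l | _) _)^-1 (z ^ nmax) (z ^ (- n i)) => A B x y.
    by ring.
  have -> : laurent_term c nmax z = (fun k => \sum_i prefactor a b m n i *
     laurent_term (fun t => int_ext (cauchy_conv (left_coef a b i) (right_coef a b m n i)) (t + n i)) nmax z k).
    apply/funext => k; rewrite /laurent_term /c /laurent_coef mulr_suml.
    by apply: eq_bigr => i _; rewrite mulrA.
  apply: cvg_series_sum => i; apply: cvg_seriesM; apply: cvg_int_ext.
    by rewrite gez0_abs ?subr_ge0.
  apply: hypergeom_product_cvg => //.
  - by rewrite !size_image cardC1 !card_ord prednK // ltnW.
  - by rewrite !size_image cardC1 !card_ord prednK // ltnW.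
  - move=> x /mapP[l]; rewrite mem_enum => li -> k e; apply: (a_distinct l i li (k - 1)).
    by rewrite intrB -e; ring.
  - move=> x /mapP[l]; rewrite mem_enum => li -> k e; apply: (a_distinct l i li (- k + 1 + (n l - n i))).
    by rewrite intrD [(- k + 1)%:~R]intrD [(- k)%:~R]intrN -e; ring.
(* The number of exponents from - nmax to p - mmin, 0 if there are none. *)
pose Kf := if p - mmin + nmax + 1 is Posz k then k else 0%N.
have KfP (k : nat) : (k < Kf)%N = (k%:Z - nmax <= p - mmin).
  have -> : (k%:Z - nmax <= p - mmin) = (k%:Z < p - mmin + nmax + 1) by lia.
  by rewrite /Kf; case: (p - mmin + nmax + 1) => //= e; lia.
have := cvg_finite_series (n := Kf) _ (cvg_iter_bdiff (q := q) c0 cS).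
rewrite /laurent_term => /(_ _)/= e.
have {}e : (1 - z) ^+ q * (z ^ nmax * S) =
    \sum_(0 <= k < Kf) iter q (@bdiff _) c (k%:Z - nmax) * z ^+ k.
  apply: e => k; rewrite leqNgt KfP => /negP kK.
  by rewrite cq ?mul0r //; lia.
have -> : - p - 1 = - q%:Z by rewrite qE; lia.
have -> : [set j : int | - nmax <= j <= p - mmin] =
    [set` [seq k%:Z - nmax | k <- index_iota 0 Kf]].
  apply/seteqP; split=> j /=.
    move=> /andP[j1 j2]; apply/mapP; exists (absz (j + nmax)).
      by rewrite mem_index_iota KfP; lia.
    by lia.
  move=> /mapP[k]; rewrite mem_index_iota KfP => /andP[_ kK] ->.
  by lia.
rewrite -fsbig_seq; last by rewrite map_inj_uniq ?iota_uniq // => x y; lia.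
rewrite big_map -exprnN -[LHS](mulKf (expf_neq0 q z1)).
congr (_ * _).
have zn : z ^ nmax != 0 by rewrite expfz_neq0.
apply: (mulfI zn); rewrite mulrCA e mulr_sumr; apply: eq_bigr => k _.
by rewrite /= mulrCA; congr (_ * _); rewrite -expfzDr // subrKC.
Qed.
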